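(* Let $G$ be an affine algebraic group over $\Bbbk$ and $R$ a rational $G$-module algebra. Then the following conditions are equivalent: (1) The action of $G$ on $R$ is linearly reductive. (2) If $\varphi: M \to N$ is a surjective morphism in the category ${}_{(G,R)}\mathcal{M}$, then $\varphi({}^G M) = {}^G N$. (3) If $M \in {}_{(G,R)}\mathcal{M}$, then the rational cohomology groups $\operatorname{H}^n(G,M)$ are $\{0\}$ for all $n \neq 0$. (4) There exists a total integral $\sigma: \Bbbk[G] \to R$. (5) The $G$-module algebra $R$ is an injective object in the category ${}_G\mathcal{M}$. (6) Every object $M \in {}_{(G,R)}\mathcal{M}$ is injective in ${}_G\mathcal{M}$.
   Context: $\Bbbk$ is an algebraically closed field; all algebras are commutative. ${}_G\mathcal{M}$ is the category of rational $G$-modules (equivalently $\Bbbk[G]$-comodules), and ${}^G M$ is the submodule of $G$-fixed elements of $M$. A rational $G$-module algebra is a commutative $\Bbbk$-algebra $R$ that is a rational $G$-module with $G$ acting by algebra automorphisms. ${}_{(G,R)}\mathcal{M}$ is the category of rational $(G,R)$-modules: objects are rational $G$-modules $M$ that are also $R$-modules with $x\cdot(rm) = (x\cdot r)(x\cdot m)$ for $x\in G$, $r\in R$, $m\in M$; morphisms are the maps that are both $G$-equivariant and $R$-linear. The action of $G$ on $R$ is linearly reductive if for every triple $(M,J,\lambda)$, where $M\in {}_{(G,R)}\mathcal{M}$, $J\subseteq R$ is a $G$-stable ideal and $\lambda: M\to R/J$ is a surjective morphism of $(G,R)$-modules, there exists $m\in {}^G M$ with $\lambda(m) = 1+J$.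 The functors $M\mapsto \operatorname{H}^n(G,M)$ are the derived functors of $M\mapsto {}^G M$ on ${}_G\mathcal{M}$. A (left) integral for $G$ with values in $R$ is a $G$-equivariant linear map $\sigma:\Bbbk[G]\to R$, where $G$ acts on $\Bbbk[G]$ by $(x\cdot f)(g) = f(gx)$; it is total if $\sigma(1)=1$. *)

(* Defs.v *)
From HB Require Import structures.
From mathcomp Require Import all_boot all_order all_algebra.
From mathcomp Require Import boolp classical_sets functions.

Set Implicit Arguments.
Unset Strict Implicit.
Unset Printing Implicit Defensive.

Import GRing.Theory.
Local Open Scope classical_set_scope.
Local Open Scope ring_scope.

(* Restriction of scalars along [iota]. *)
Definition restr (k A : pzRingType) (iota : {rmorphism k -> A})
  (V : lmodType A) : Type := V.

Section Restriction.
Variables (k A : pzRingType) (iota : {rmorphism k -> A}) (V : lmodType A).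
Local Notation restrV := (restr iota V).

HB.instance Definition _ := GRing.Zmodule.on restrV.

Definition restr_scale (c : k) (v : restrV) : restrV := iota c *: (v : V).
Fact restr_scaleA a b v :
  restr_scale a (restr_scale b v) = restr_scale (a * b) v.
Proof. by rewrite /restr_scale rmorphM scalerA. Qed.
Fact restr_scale1 : left_id 1 restr_scale.
Proof. by move=> v; rewrite /restr_scale rmorph1 scale1r. Qed.
Fact restr_scaleDr : right_distributive restr_scale +%R.
Proof. by move=> a u v; rewrite /restr_scale -scalerDr. Qed.
Fact restr_scaleDl v : {morph restr_scale^~ v : a b / a + b}.
Proof. by move=> a b; rewrite /restr_scale rmorphD scalerDl. Qed.
HB.instance Definition _ := GRing.Zmodule_isLmodule.Build k restrV
  restr_scaleA restr_scale1 restr_scaleDr restr_scaleDl.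

Lemma restr_scaleE (c : k) (v : V) : c *: (v : restrV) = iota c *: v :> V.
Proof. by []. Qed.

End Restriction.

Section LmodSub.
Variables (A : pzRingType) (V : lmodType A).
Variables (S : {pred V}) (clS : GRing.submod_closed S).

Record lsub := LSub { lsub_val : V; lsub_valP : lsub_val \in S }.
HB.instance Definition _ := [isSub for lsub_val].
HB.instance Definition _ := [Choice of lsub by <:].

(* [lsub] with the closure proof as an argument, so that the module structure
   can be inferred. *)
Definition lsubmod (_ : GRing.submod_closed S) : Type := lsub.
HB.instance Definition _ := SubChoice.on (lsubmod clS).
HB.instance Definition _ := GRing.SubChoice_isSubLmodule.Build A V S
  (lsubmod clS) (GRing.submod_closed_semi clS).

End LmodSub.

Section LmodQuotient.
Variables (A : pzRingType) (V : lmodType A) (S : {pred V}) (clS : GRing.submod_closed S).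

Definition lq_mem (_ : GRing.submod_closed S) : {pred V} := S.
HB.instance Definition _ :=
  GRing.isZmodClosed.Build V (lq_mem clS) (GRing.submod_closedB clS).

Definition lquot : Type := Quotient.quot (lq_mem clS).
HB.instance Definition _ := GRing.Zmodule.on lquot.

Definition lquot_pi (v : V) : lquot := \pi_(Quotient.quot (lq_mem clS))%qT v.
Fact lquot_pi_is_zmod_morphism : zmod_morphism lquot_pi.
Proof. by move=> x y; rewrite /lquot_pi raddfB. Qed.
HB.instance Definition _ :=
  GRing.isZmodMorphism.Build V lquot lquot_pi lquot_pi_is_zmod_morphism.

Lemma lquot_piP u v : lquot_pi u = lquot_pi v <-> u - v \in S.
Proof.
rewrite -[_ \in S]/(u - v \in lq_mem clS) Quotient.idealrBE.
by split=> /eqP.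
Qed.

Definition lquot_repr (q : lquot) : V := repr (q : Quotient.quot (lq_mem clS)).
Lemma lquot_reprK : cancel lquot_repr lquot_pi. Proof. exact: reprK. Qed.

Definition lquot_scale (a : A) (q : lquot) := lquot_pi (a *: lquot_repr q).
Lemma lquot_scaleE a v : lquot_scale a (lquot_pi v) = lquot_pi (a *: v).
Proof.
apply/lquot_piP; rewrite -scalerBr -[_ *: _]addr0.
case: clS => S0; apply=> //; by apply/lquot_piP; rewrite lquot_reprK.
Qed.

Fact lquot_scaleA a b q :
  lquot_scale a (lquot_scale b q) = lquot_scale (a * b) q.
Proof. by rewrite -(lquot_reprK q) !lquot_scaleE scalerA. Qed.
Fact lquot_scale1 : left_id 1 lquot_scale.
Proof. by move=> q; rewrite -(lquot_reprK q) lquot_scaleE scale1r. Qed.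
Fact lquot_scaleDr : right_distributive lquot_scale +%R.
Proof.
move=> a p q; rewrite -(lquot_reprK p) -(lquot_reprK q) -raddfD !lquot_scaleE.
by rewrite scalerDr raddfD.
Qed.
Fact lquot_scaleDl q : {morph lquot_scale^~ q : a b / a + b}.
Proof.
by move=> a b /=; rewrite -(lquot_reprK q) !lquot_scaleE scalerDl raddfD.
Qed.
HB.instance Definition _ := GRing.Zmodule_isLmodule.Build A lquot
  lquot_scaleA lquot_scale1 lquot_scaleDr lquot_scaleDl.

Fact lquot_pi_scalable : scalable lquot_pi.
Proof. by move=> a v; rewrite -lquot_scaleE. Qed.
HB.instance Definition _ :=
  GRing.isScalable.Build A V lquot *:%R lquot_pi lquot_pi_scalable.

End LmodQuotient.

Section LinearExtension.
Variables (k : fieldType) (A B V : lmodType k).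
Variables (i : {linear A -> B}) (f : {linear A -> V}).
Hypothesis i_inj : injective i.

Let good (D : set (B * V)) : Prop :=
  [/\ forall a, D (i a, f a),
      forall c p q, D p -> D q -> D (c *: p + q) &
      forall v, D (0, v) -> v = 0].

Let graph_good : good [set (i a, f a) | a in [set: A]].
Proof.
split=> [a|c _ _ [a _ <-] [b _ <-]|v [a _ [ia0 <-]]]; first by exists a.
  by exists (c *: a + b) => //; rewrite !linearP.
by rewrite (_ : a = 0) ?linear0 //; apply: i_inj; rewrite linear0.
Qed.

Lemma linear_extension : exists g : {linear B -> V}, forall a, g (i a) = f a.
Proof.
have [|D [[->|gD] Dmax]] := @Zorn_bigcup (B * V)%type (fun D => D = set0 \/ good D).
- move=> F FP Ftot.
  have [[D0 [FD0 gD0]]|noF] := pselect (exists D, F D /\ good D); last first.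
    left; rewrite -subset0 => p [D FD Dp].
    by have [D0|gD] := FP _ FD; [rewrite D0 in Dp | case: noF; exists D].
  right; split=> [a|c p q [D1 FD1 p1] [D2 FD2 q2]|v [D FD Dv]].
  + by exists D0 => //; case: gD0.
  + have g1 : good D1 by have [E|//] := FP _ FD1; rewrite E in p1.
    have g2 : good D2 by have [E|//] := FP _ FD2; rewrite E in q2.
    have [le|le] := Ftot _ _ FD1 FD2.
      by exists D2 => //; case: g2 => _ cl _; apply: cl => //; apply: le.
    by exists D1 => //; case: g1 => _ cl _; apply: cl => //; apply: le.
  + have : good D by have [E|//] := FP _ FD; rewrite E in Dv.
    by case=> _ _; apply.
- have /Dmax : set0 `<` [set (i a, f a) | a in [set: A]].
    split=> [|/(_ (i 0, f 0))]; first exact: sub0set.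
    by apply; exists 0.
  by case; right; apply: graph_good.
have [Dif Dlin Dfun] := gD.
have D0 : D (0, 0) by have := Dif 0; rewrite !linear0.
have fun2 b v w : D (b, v) -> D (b, w) -> v = w.
  move=> Dv Dw; have := Dlin (-1) _ _ Dw Dv.
  rewrite scaleN1r -[_ + _]/(- b + b, - w + v) addNr => /Dfun /eqP.
  by rewrite addrC subr_eq0 => /eqP.
have tot b : exists v, D (b, v).
  apply: contrapT => nob.
  pose E := [set p | exists c q, D q /\ p = (c *: b, 0) + q].
  have DE : D `<` E.
    split=> [p Dp|ED].
      by exists 0, p; split=> //; rewrite scale0r [RHS]add0r.
    apply: nob; exists 0; apply: ED; exists 1, 0; split=> //.
    by rewrite addr0 scale1r.
  apply: (Dmax E DE); right; split=> [a|c p q [c1 [q1 [Dq1 ->]]] [c2 [q2 [Dq2 ->]]]|v].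
  - by apply: DE.1.
  - exists (c * c1 + c2), (c *: q1 + q2); split; first exact: Dlin.
    rewrite scalerDr addrACA; congr (_ + _).
    rewrite -[RHS]/(_, _); congr pair; rewrite /= ?scaler0 ?addr0 //.
    by rewrite scalerDl scalerA.
  - move=> [c [[b' v'] [Dq [/= cb ->]]]]; rewrite add0r.
    have [c0|cn0] := eqVneq c 0.
      apply: Dfun; suff -> : 0 = b' by [].
      by rewrite cb c0 scale0r add0r.
    case: nob; exists (- c^-1 *: v').
    have := Dlin (- c^-1) _ _ Dq D0; rewrite addr0 -[_ *: _]/(_, _) /=.
    suff -> : - c^-1 *: b' = b by [].
    have -> : b' = - (c *: b) by apply/eqP; rewrite -addr_eq0 addrC -cb.
    by rewrite scalerN scaleNr opprK scalerA mulVf // scale1r.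
pose g b := sval (cid (tot b)).
have gP b : D (b, g b) by rewrite /g; case: cid.
have g_lin : linear g.
  by move=> c x y; apply: fun2 (gP _) _; apply: (Dlin c _ _ (gP x) (gP y)).
pose G := GRing.isLinear.Build k B V *:%R g g_lin.
exists (HB.pack_for {linear B -> V} g G) => a /=.
exact: fun2 (gP _) (Dif _).
Qed.

End LinearExtension.

(* An affine algebraic group in the classical sense: an abstract group G, its
   algebra k[G] of regular functions, and the value [evalG x f] of f at x.
   [evalG_inj] makes k[G] an algebra of functions on G, and [points_inj] and
   [points_surj] identify G with the maximal spectrum of k[G]. *)
Record affAlgGroup (k : closedFieldType) := AffAlgGroup {
  aag_sort :> groupType;
  coord : comAlgType k;
  evalG : aag_sort -> {lrmorphism coord -> k^o};
  evalG_inj : forall f g : coord, (forall x, evalG x f = evalG x g) -> f = g;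
  coord_fingen : exists (n : nat) (t : 'I_n -> coord),
    forall S : {pred coord}, GRing.subalg_closed S ->
      (forall i, t i \in S) -> forall f, f \in S;
  points_inj : forall x y : aag_sort,
    (forall f, evalG x f = evalG y f) -> x = y;
  points_surj : forall phi : {lrmorphism coord -> k^o},
    exists x, forall f, phi f = evalG x f;
  evalG_mul : forall f : coord, exists (n : nat) (a b : 'I_n -> coord),
    forall x y, evalG (x * y)%g f = \sum_(i < n) evalG x (a i) * evalG y (b i);
  evalG_inv : forall f : coord, exists f' : coord,
    forall x, evalG (x^-1)%g f = evalG x f'
}.

Section Rational.
Variables (k : closedFieldType) (G : affAlgGroup k).

(* The maps G -> V that lie in V (x) k[G]. *)
Definition regular_map (V : lmodType k) (F : G -> V) : Prop :=
  exists (n : nat) (f : 'I_n -> coord G) (e : 'I_n -> V),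
    forall x, F x = \sum_(i < n) evalG x (f i) *: e i.

(* The last clause is rationality: the orbit maps x |-> x . m of a comodule are
   the values of its coaction M -> M (x) k[G]. *)
Definition rational_action (M : lmodType k) (act : G -> M -> M) : Prop :=
  [/\ forall x, linear (act x),
      forall m, act 1%g m = m,
      forall x y m, act (x * y)%g m = act x (act y m) &
      forall m, regular_map (act^~ m)].

Record ratModule := RatModule {
  rm_sort :> lmodType k;
  act : G -> rm_sort -> rm_sort;
  actP : rational_action act
}.

Definition equivariant (M N : ratModule) (f : M -> N) : Prop :=
  forall x m, f (act x m) = act x (f m).

Definition fixed (M : ratModule) : set M := [set m | forall x, act x m = m].

(* Injective objects of the category of rational G-modules; its monomorphisms
   are the injective morphisms. *)
Definition injective_object (I : ratModule) : Prop :=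
  forall (A B : ratModule) (i : {linear A -> B}) (f : {linear A -> I}),
    equivariant i -> equivariant f -> injective i ->
    exists2 g : {linear B -> I}, equivariant g & forall a, g (i a) = f a.

Section RatModuleTheory.
Variable M : ratModule.

Lemma act_linear x : linear (@act M x). Proof. by case: (actP M). Qed.
HB.instance Definition _ x :=
  GRing.isLinear.Build k M M *:%R (@act M x) (act_linear x).
Lemma act1 (m : M) : act 1%g m = m. Proof. by case: (actP M). Qed.
Lemma actM x y (m : M) : act (x * y)%g m = act x (act y m).
Proof. by case: (actP M). Qed.
Lemma act_rational (m : M) : regular_map (fun x => act x m).
Proof. by case: (actP M). Qed.

End RatModuleTheory.

Lemma rtrans_ex (x : G) (f : coord G) :
  exists f' : coord G, forall y, evalG y f' = evalG (y * x)%g f.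
Proof.
have [n [a [b fE]]] := evalG_mul f.
exists (\sum_(i < n) evalG x (b i) *: a i) => y.
rewrite fE linear_sum; apply: eq_bigr => i _.
by rewrite linearZ /= [LHS]mulrC.
Qed.

Definition rtrans (x : G) (f : coord G) : coord G := sval (cid (rtrans_ex x f)).

Lemma evalG_rtrans x f y : evalG y (rtrans x f) = evalG (y * x)%g f.
Proof. by rewrite /rtrans; case: cid. Qed.

Lemma rtrans_rational : rational_action rtrans.
Proof.
split; [move=> x a f g|move=> f|move=> x y f|move=> f].
- by apply: evalG_inj => y; rewrite [RHS]linearP /= !evalG_rtrans linearP.
- by apply: evalG_inj => y; rewrite evalG_rtrans mulg1.
- by apply: evalG_inj => z; rewrite !evalG_rtrans mulgA.
have [n [a [b fE]]] := evalG_mul f; exists n, b, a => x.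
apply: evalG_inj => y; rewrite evalG_rtrans fE linear_sum.
by apply: eq_bigr => i _; rewrite linearZ /= [LHS]mulrC.
Qed.

(* k[G] with (x . f)(y) = f (y x). *)
Definition coord_mod : ratModule := RatModule rtrans_rational.

Record injective_resolution (M : ratModule) := InjectiveResolution {
  res : nat -> ratModule;
  aug : {linear M -> res 0};
  diff : forall n, {linear res n -> res n.+1};
  aug_equiv : equivariant aug;
  diff_equiv : forall n, equivariant (diff n);
  res_injective : forall n, injective_object (res n);
  aug_inj : injective aug;
  aug_exact : forall z, diff 0 z = 0 <-> exists m, aug m = z;
  diff_exact : forall n z, diff n.+1 z = 0 <-> exists y, diff n y = z
}.

End Rational.

Arguments fixed {k G} M _.

Section Cofree.
Variables (k : closedFieldType) (G : affAlgGroup k).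

Section RegularMap.
Variable V : lmodType k.

Lemma regular_map0 : regular_map (0 : G -> V).
Proof.
by exists 0, (fun=> 0), (fun=> 0) => x; rewrite big_ord0.
Qed.

Lemma regular_mapD (F F' : G -> V) :
  regular_map F -> regular_map F' -> regular_map (F + F').
Proof.
move=> [n [f [e FE]]] [n' [f' [e' FE']]].
exists (n + n')%N,
  (fun i => match fintype.split i with inl j => f j | inr j => f' j end),
  (fun i => match fintype.split i with inl j => e j | inr j => e' j end) => x.
rewrite -[LHS]/(F x + F' x) FE FE' big_split_ord /=; congr (_ + _).
  by apply: eq_bigr => j _; rewrite (unsplitK (inl j)).
by apply: eq_bigr => j _; rewrite (unsplitK (inr j)).
Qed.

Lemma regular_map_sum n (F : 'I_n -> G -> V) :
  (forall i, regular_map (F i)) -> regular_map (\sum_(i < n) F i).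
Proof.
move=> FP; apply: big_ind => [||i _]; [exact: regular_map0| |exact: FP].
by move=> ? ?; exact: regular_mapD.
Qed.

Definition tensor (f : coord G) (v : V) : G -> V := fun x => evalG x f *: v.
Lemma regular_tensor f v : regular_map (tensor f v).
Proof. by exists 1, (fun=> f), (fun=> v) => x; rewrite big_ord1. Qed.

Lemma regular_mapE (F : G -> V) : regular_map F ->
  exists (n : nat) (f : 'I_n -> coord G) (e : 'I_n -> V),
    F = \sum_(i < n) tensor (f i) (e i).
Proof.
by move=> [n [f [e FE]]]; exists n, f, e; apply/funext=> x; rewrite FE fct_sumE.
Qed.

Definition regular_mem : {pred G -> V} := fun F => `[< regular_map F >].
Fact regular_mem_closed : GRing.submod_closed regular_mem.
Proof.
split=> [|a F F' /asboolP FP /asboolP FP']; apply/asboolP.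
  exact: regular_map0.
apply: regular_mapD => //; have [n [f [e FE]]] := FP.
exists n, f, (fun i => a *: e i) => x.
rewrite -[LHS]/(a *: F x) FE scaler_sumr; apply: eq_bigr => i _.
by rewrite !scalerA mulrC.
Qed.

(* V (x) k[G] as the space of regular maps G -> V, with (x . F)(y) = F (y x). *)
Definition cofree : lmodType k := lsubmod regular_mem_closed.

Definition cofree_fun (F : cofree) : G -> V := val F.
Lemma cofreeP (F : cofree) : regular_map (cofree_fun F).
Proof. exact/asboolP/(valP F). Qed.
Definition Cofree (F : G -> V) (FP : regular_map F) : cofree :=
  LSub (S := regular_mem) (introT (asboolP _) FP).
Lemma cofree_inj (F F' : cofree) : cofree_fun F =1 cofree_fun F' -> F = F'.
Proof. by move=> /funext FF'; apply: val_inj. Qed.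
Lemma cofree_fun_linear x : linear (fun F : cofree => cofree_fun F x).
Proof. by move=> a F F'; rewrite /cofree_fun linearP. Qed.

Fact cofree_act_proof x (F : cofree) :
  regular_map (fun y => cofree_fun F (y * x)%g).
Proof.
have [n [f [e FE]]] := cofreeP F.
exists n, (fun i => rtrans x (f i)), e => y; rewrite FE.
by apply: eq_bigr => i _; rewrite evalG_rtrans.
Qed.
Definition cofree_act x (F : cofree) : cofree := Cofree (cofree_act_proof x F).
Lemma cofree_actE x F y : cofree_fun (cofree_act x F) y = cofree_fun F (y * x)%g.
Proof. by []. Qed.

End RegularMap.

Lemma cofree_act_rational (V : lmodType k) : rational_action (@cofree_act V).
Proof.
have lin x : linear (@cofree_act V x).
  by move=> a F F'; apply: cofree_inj => y; rewrite cofree_fun_linear !cofree_actE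
    cofree_fun_linear.
split=> //; [move=> F|move=> x y F|move=> F].
- by apply: cofree_inj => y; rewrite cofree_actE mulg1.
- by apply: cofree_inj => z; rewrite !cofree_actE mulgA.
have [n [f [e FE]]] := regular_mapE (cofreeP F).
pose T i := Cofree (regular_tensor (f i) (e i)).
have -> : F = \sum_(i < n) T i.
  by apply: val_inj; rewrite (raddf_sum val) -[LHS]/(cofree_fun F) FE.
have -> : (fun x => cofree_act x (\sum_(i < n) T i)) =
    \sum_(i < n) (fun x => cofree_act x (T i)).
  apply/funext => x; rewrite fct_sumE.
  pose L := HB.pack_for {linear cofree V -> cofree V} (@cofree_act V x)
    (GRing.isLinear.Build k _ _ *:%R _ (lin x)).
  exact: (raddf_sum L).
apply: regular_map_sum => i.
have [m [a [b fE]]] := evalG_mul (f i).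
exists m, b, (fun j => Cofree (regular_tensor (a j) (e i))) => x.
apply: cofree_inj => y.
rewrite cofree_actE /cofree_fun (raddf_sum val) fct_sumE /= /tensor fE scaler_suml.
by apply: eq_bigr => j _; rewrite mulrC -scalerA.
Qed.

Definition cofree_mod (V : lmodType k) : ratModule G :=
  RatModule (@cofree_act_rational V).

Lemma cofree_injective V : injective_object (cofree_mod V).
Proof.
move=> A B i f i_eq f_eq i_inj.
pose f1 (a : A) : V := cofree_fun (f a) 1%g.
have f1_lin : linear f1.
  by move=> c a b; rewrite /f1 linearP cofree_fun_linear.
pose F1 := HB.pack_for {linear A -> V} f1 (GRing.isLinear.Build k _ _ *:%R _ f1_lin).
have [g1 g1E] := linear_extension F1 i_inj.
have gP b : regular_map (fun x => g1 (act x b)).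
  have [n [h [e eE]]] := act_rational b.
  exists n, h, (g1 \o e) => x; rewrite eE linear_sum.
  by apply: eq_bigr => j _; rewrite linearZ.
pose g b : cofree_mod V := Cofree (gP b).
have g_lin : linear g.
  move=> c a b; apply: cofree_inj => x; rewrite cofree_fun_linear /=.
  by rewrite -[LHS]/(g1 (act x _)) !linearP.
exists (HB.pack_for {linear B -> cofree_mod V} g (GRing.isLinear.Build k _ _ *:%R _ g_lin)).
  by move=> x b; apply: cofree_inj => y; rewrite cofree_actE /= /cofree_fun /= actM.
move=> a; apply: cofree_inj => x.
rewrite -[LHS]/(g1 (act x (i a))) -i_eq g1E -[LHS]/(cofree_fun (f (act x a)) 1%g).
by rewrite f_eq cofree_actE mul1g.
Qed.

Section Coaction.
Variable M : ratModule G.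

Definition coaction (m : M) : cofree_mod M := Cofree (act_rational m).
Fact coaction_linear : linear coaction.
Proof.
move=> c a b; apply: cofree_inj => x; rewrite cofree_fun_linear.
by rewrite -[LHS]/(act x _) linearP.
Qed.
HB.instance Definition _ :=
  GRing.isLinear.Build k M (cofree_mod M) *:%R coaction coaction_linear.

Lemma coaction_equiv : equivariant coaction.
Proof.
by move=> x m; apply: cofree_inj => y; rewrite cofree_actE -[LHS]/(act y _) -actM.
Qed.
Lemma coaction_inj : injective coaction.
Proof.
move=> m n /(congr1 (fun F => cofree_fun F 1%g)).
by rewrite -[LHS]/(act 1%g m) -[RHS]/(act 1%g n) !act1.
Qed.

Definition coim_mem : {pred cofree_mod M} := fun F => `[< exists m, coaction m = F >].
Fact coim_closed : GRing.submod_closed coim_mem.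
Proof.
split=> [|a _ _ /asboolP[m <-] /asboolP[n <-]]; apply/asboolP.
  by exists 0; rewrite linear0.
by exists (a *: m + n); rewrite linearP.
Qed.

(* The cokernel of the coaction. *)
Definition coker : lmodType k := lquot coim_closed.
Definition coker_pi : {linear cofree_mod M -> coker} := @lquot_pi _ _ _ coim_closed.
Lemma coker_piP F F' : coker_pi F = coker_pi F' <-> exists m, coaction m = F - F'.
Proof. by rewrite lquot_piP; split=> /asboolP. Qed.
Lemma coker_reprK (q : coker) : coker_pi (lquot_repr q) = q.
Proof. exact: lquot_reprK. Qed.

Definition coker_act x (q : coker) : coker := coker_pi (act x (lquot_repr q)).
Lemma coker_actE x F : coker_act x (coker_pi F) = coker_pi (act x F).
Proof.
apply/coker_piP; rewrite -(raddfB (@act _ _ _ x)).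
have [m mE] := (coker_piP _ _).1 (coker_reprK (coker_pi F)).
by exists (act x m); rewrite coaction_equiv mE.
Qed.
Fact coker_act_rational : rational_action coker_act.
Proof.
split; [move=> x a p q|move=> q|move=> x y q|move=> q].
- rewrite -(coker_reprK p) -(coker_reprK q) -linearP !coker_actE.
  by rewrite [act x _]linearP linearP.
- by rewrite -(coker_reprK q) coker_actE act1.
- by rewrite -(coker_reprK q) !coker_actE actM.
have [n [f [e eE]]] := act_rational (lquot_repr q : cofree_mod M).
exists n, f, (coker_pi \o e) => x; rewrite -{1}(coker_reprK q) coker_actE eE.
by rewrite linear_sum; apply: eq_bigr => i _; rewrite linearZ.
Qed.
Definition coker_mod : ratModule G := RatModule coker_act_rational.

End Coaction.

Section StandardResolution.
Variable M : ratModule G.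

Fixpoint syzygy (n : nat) : ratModule G :=
  if n is m.+1 then coker_mod (syzygy m) else M.

Definition std_diff n :
    {linear cofree_mod (syzygy n) -> cofree_mod (syzygy n.+1)} :=
  @coaction (syzygy n.+1) \o @coker_pi (syzygy n).

Fact std_diff_equiv n : equivariant (std_diff n).
Proof.
move=> x F; rewrite -[LHS]/(coaction (coker_pi (syzygy n) (act x F) : syzygy n.+1)).
by rewrite -coker_actE [LHS]coaction_equiv.
Qed.

Fact std_ker n z : std_diff n z = 0 <-> exists m, coaction m = z.
Proof.
rewrite -[std_diff n z]/(coaction (coker_pi (syzygy n) z : syzygy n.+1)).
rewrite -[z in _ <-> exists m, _ = z]subr0 -coker_piP.
split=> [|zE].
  by rewrite -(linear0 (@coaction (syzygy n.+1))) => /coaction_inj ->; rewrite linear0.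
by rewrite zE linear0 linear0.
Qed.

Definition std_resolution : injective_resolution M.
Proof.
refine (@InjectiveResolution k G M (fun n => cofree_mod (syzygy n))
  (@coaction M) std_diff (@coaction_equiv M) std_diff_equiv
  (fun n => @cofree_injective (syzygy n)) (@coaction_inj M) (std_ker (n := 0)) _).
move=> n z; rewrite std_ker; split=> [[q <-]|[y <-]].
  by exists (lquot_repr (q : coker (syzygy n))); congr coaction; apply: coker_reprK.
by exists (coker_pi _ y).
Defined.

End StandardResolution.
End Cofree.

Section Cohomology.
Variables (k : closedFieldType) (G : affAlgGroup k) (M : ratModule G).
Variables (I : injective_resolution M) (n : nat).

Definition cocycle_mem : {pred res I n} :=
  fun z => `[< fixed (res I n) z /\ diff I n z = 0 >].
Fact cocycle_closed : GRing.submod_closed cocycle_mem.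
Proof.
split=> [|a u v /asboolP[fu du] /asboolP[fv dv]]; apply/asboolP.
  by split=> [x|]; rewrite linear0.
split=> [x|]; first by rewrite linearP /= fu fv.
by rewrite linearP /= du dv scaler0 addr0.
Qed.
Definition cocycle : lmodType k := lsubmod cocycle_closed.

Definition coboundary (n : nat) : set (res I n) :=
  match n with
  | 0 => [set 0]
  | m.+1 => [set diff I m y | y in fixed (res I m)]
  end.
Definition coboundary_mem : {pred cocycle} :=
  fun z => `[< coboundary (val z) >].
Fact coboundary_closed : GRing.submod_closed coboundary_mem.
Proof.
have [b0 bP] : coboundary (0 : res I n) /\
    (forall a u v, @coboundary n u -> @coboundary n v -> coboundary (a *: u + v)).
  case: n => [|m] /=; split=> //.
  - by move=> a u v -> ->; rewrite scaler0 addr0.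
  - by exists 0; [move=> x|]; rewrite linear0.
  - move=> a _ _ [y fy <-] [z fz <-]; exists (a *: y + z); last by rewrite linearP.
    by move=> x; rewrite linearP /= fy fz.
split=> [|a u v /asboolP bu /asboolP bv]; apply/asboolP; first by rewrite raddf0.
by rewrite linearP; apply: bP.
Qed.

(* The n-th cohomology of the complex of fixed points of I. *)
Definition cohomology : lmodType k := lquot coboundary_closed.

End Cohomology.

(* The right derived functors of M |-> M^G, computed with the resolution
   M -> M (x) k[G] -> C (x) k[G] -> ..., where C = (M (x) k[G]) / M, and so on. *)
Definition ratH (k : closedFieldType) (G : affAlgGroup k) (n : nat)
  (M : ratModule G) : lmodType k := cohomology (std_resolution M) n.

Section Algebras.
Variables (k : closedFieldType) (G : affAlgGroup k).

(* A commutative k-algebra is a commutative ring R, possibly zero, with a ring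
   morphism k -> R. *)
Record ratAlgebra := RatAlgebra {
  ra_ring :> comPzRingType;
  ra_unit : {rmorphism k -> ra_ring};
  ra_act : G -> ra_ring -> ra_ring;
  ra_actP : rational_action (M := restr ra_unit ra_ring^o) ra_act;
  ra_act_one : forall x, ra_act x 1 = 1;
  ra_act_mul : forall x r s, ra_act x (r * s) = ra_act x r * ra_act x s
}.

Definition ra_mod (R : ratAlgebra) : ratModule G := RatModule (@ra_actP R).

(* The k-structure of a (G,R)-module is the restriction of its R-structure. *)
Record grModule (R : ratAlgebra) := GRModule {
  gr_sort :> lmodType R;
  gr_act : G -> gr_sort -> gr_sort;
  gr_actP : rational_action (M := restr (ra_unit R) gr_sort) gr_act;
  gr_act_scale : forall x (r : R) (m : gr_sort),
    gr_act x (r *: m) = ra_act x r *: gr_act x m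
}.

Definition gr_mod (R : ratAlgebra) (M : grModule R) : ratModule G :=
  RatModule (@gr_actP R M).

Section GIdeal.
Variable R : ratAlgebra.

Record gIdeal := GIdeal {
  gi_set : set R;
  gi0 : gi_set 0;
  giD : forall r s, gi_set r -> gi_set s -> gi_set (r + s);
  giM : forall a r, gi_set r -> gi_set (a * r);
  gi_act : forall x r, gi_set r -> gi_set (ra_act x r)
}.

Variable J : gIdeal.

Definition gi_mem : {pred R^o} := fun r => `[< gi_set J r >].
Fact gi_mem_closed : GRing.submod_closed gi_mem.
Proof.
split; first exact/asboolP/gi0.
by move=> a u v /asboolP Ju /asboolP Jv; apply/asboolP/giD => //; apply: giM.
Qed.

Definition quotR : lmodType R := lquot gi_mem_closed.
Definition quotR_pi : {linear R^o -> quotR} := @lquot_pi R R^o gi_mem gi_mem_closed.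

Lemma quotR_piP (r s : R) : quotR_pi r = quotR_pi s <-> gi_set J (r - s).
Proof. by rewrite lquot_piP; split=> /asboolP. Qed.

Definition quotR_repr (q : quotR) : R := lquot_repr q.
Lemma quotR_reprK q : quotR_pi (quotR_repr q) = q.
Proof. exact: lquot_reprK. Qed.

Definition quotR_act (x : G) (q : quotR) : quotR :=
  quotR_pi (ra_act x (quotR_repr q)).
Lemma quotR_actE x (r : R) : quotR_act x (quotR_pi r) = quotR_pi (ra_act x r).
Proof.
apply/quotR_piP; rewrite -(raddfB (@act _ _ (ra_mod R) x)); apply: gi_act.
by apply/quotR_piP; rewrite quotR_reprK.
Qed.

Fact quotR_act_rational :
  rational_action (M := restr (ra_unit R) quotR) quotR_act.
Proof.
have [lin one mul rat] := ra_actP R.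
split; [move=> x a p q|move=> q|move=> x y q|move=> q].
- rewrite !restr_scaleE -(quotR_reprK p) -(quotR_reprK q).
  rewrite -[LHS]/(quotR_act x (ra_unit R a *: quotR_pi _ + quotR_pi _)).
  rewrite -linearP !quotR_actE.
  exact: etrans (congr1 quotR_pi (lin _ _ _ _)) (linearP _ _ _ _).
- by rewrite -(quotR_reprK q) quotR_actE one.
- by rewrite -(quotR_reprK q) !quotR_actE mul.
have [n [f [e eE]]] := rat (quotR_repr q).
exists n, f, (fun i => quotR_pi (e i)) => x.
rewrite -{1}(quotR_reprK q) quotR_actE eE [LHS](raddf_sum quotR_pi).
by apply: eq_bigr => i _; rewrite [LHS]linearZ.
Qed.

Fact quotR_act_scale x (r : R) (q : quotR) :
  quotR_act x (r *: q) = ra_act x r *: quotR_act x q.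
Proof.
rewrite -(quotR_reprK q) -linearZ !quotR_actE.
exact: etrans (congr1 quotR_pi (ra_act_mul _ _ _)) (linearZ _ _).
Qed.

(* R/J as a (G,R)-module. *)
Definition quotR_mod : grModule R :=
  GRModule quotR_act_rational quotR_act_scale.

End GIdeal.

Definition gr_equivariant (R : ratAlgebra) (M N : grModule R) (f : M -> N) :
  Prop := forall x m, f (gr_act x m) = gr_act x (f m).

Definition gr_fixed (R : ratAlgebra) (M : grModule R) : set M :=
  [set m | forall x, gr_act x m = m].

Definition linearly_reductive (R : ratAlgebra) : Prop :=
  forall (M : grModule R) (J : gIdeal R) (lambda : {linear M -> quotR_mod J}),
    gr_equivariant lambda -> (forall q, exists m, lambda m = q) ->
    exists2 m, gr_fixed m & lambda m = quotR_pi J 1.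

(* Integrals are the equivariant linear maps k[G] -> R. *)
Definition total_integral (R : ratAlgebra)
    (sigma : {linear coord_mod G -> ra_mod R}) : Prop :=
  equivariant sigma /\ sigma (1 : coord G) = (1 : R).

End Algebras.

Arguments gr_fixed {k G R} M _.

(* Main.v *)
Require Import Defs.
From HB Require Import structures.
From mathcomp Require Import all_boot all_order all_algebra.
From mathcomp Require Import boolp classical_sets functions.

(* (1) => (5) => (4) => (6) => (3) => (2) => (1), the last step being immediate.

   (1) => (5): by Zorn's lemma it suffices to extend an equivariant linear map
   f : A -> R, A a submodule of B, to some given b in B. For a linear map
   s : B -> R with s = r f on A, consider the pair of r and the function
   x |-> s (x b), on which G acts by conjugating s. These pairs form a rational
   (G,R)-module that (s, r) |-> r maps onto R, because f extends linearly. A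
   fixed pair over 1 is an extension s of f with s (x b) = x (s b), so s is
   equivariant on the submodule generated by A and b.
   (5) => (4): extend k -> R along the constants k -> k[G].
   (4) => (6): sending F : G -> M to the value of the integral, applied in the
   first factor, on x |-> x^-1 F(x) in k[G] (x) M gives an equivariant
   retraction of the coaction M -> M (x) k[G], whose target is injective.
   (6) => (3): every syzygy of M is a direct factor of a cofree module.
   (3) => (2): lift a fixed n in N to m in M, and extend the coaction of
   K = ker phi to h : M -> K (x) k[G]. The class of h(m) modulo K is fixed, so it
   is the class of a fixed element since H^1(G, K) = 0, which corrects m to a
   fixed lift. *)

Set Implicit Arguments.
Unset Strict Implicit.
Unset Printing Implicit Defensive.

Import GRing.Theory.
Local Open Scope classical_set_scope.
Local Open Scope ring_scope.

(** * Linear maps given by graphs, and functionals *)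

Definition mkLinear (k : pzRingType) (A B : lmodType k) (f : A -> B)
    (f_lin : linear f) : {linear A -> B} :=
  HB.pack_for {linear A -> B} f (GRing.isLinear.Build k A B *:%R f f_lin).

Section Graph.
Variables (k : fieldType) (B V : lmodType k) (D : set (B * V)).
Hypothesis D0 : D (0, 0).
Hypothesis Dlin : forall c p q, D p -> D q -> D (c *: p + q).
Hypothesis Dfun : forall v, D (0, v) -> v = 0.

(** By [Dfun] the first projection of [D] is injective; the second projection extends along it. *)
Lemma linear_graph_extension :
  exists g : {linear B -> V}, forall b v, D (b, v) -> g b = v.
Proof.
pose S : {pred (B * V)%type} := fun p => `[< D p >].
have clS : GRing.submod_closed S.
  split=> [|c p q /asboolP Dp /asboolP Dq]; apply/asboolP => //.
  exact: Dlin.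
have i_lin : linear (fun p : lsubmod clS => (lsub_val p).1) by [].
have f_lin : linear (fun p : lsubmod clS => (lsub_val p).2) by [].
pose i := mkLinear i_lin; pose f := mkLinear f_lin.
have i_inj : injective i.
  apply: raddf_inj => -[[b v] /= Dp]; rewrite /i /= => b0.
  apply: val_inj => /=; move/asboolP: Dp; rewrite b0 => /Dfun -> //.
have [g gE] := linear_extension f i_inj.
exists g => b v Dbv.
exact: (gE (LSub (S := S) (introT (asboolP _) Dbv))).
Qed.
End Graph.

Lemma nonzero_functional (k : fieldType) (V : lmodType k) (v : V) : v != 0 ->
  exists q : {linear V -> k^o}, q v = 1.
Proof.
move=> v0; have i_lin : linear (fun c : k^o => c *: v).
  by move=> c a b; rewrite scalerDl scalerA.
have [|q qE] := linear_extension (i := mkLinear i_lin) idfun.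
  move=> a b /= /eqP; rewrite -subr_eq0 -scalerBl scaler_eq0 (negPf v0) orbF subr_eq0.
  by move/eqP.
by exists q; have := qE 1; rewrite /= scale1r.
Qed.

(** * Regular maps and the action on the algebra *)

Section RegularMaps.
Variables (k : closedFieldType) (G : affAlgGroup k).

Lemma regular_map_comp (V W : lmodType k) (L : {linear V -> W}) (F : G -> V) :
  regular_map F -> regular_map (L \o F).
Proof.
move=> [n [f [e FE]]]; exists n, f, (L \o e) => x /=.
by rewrite FE linear_sum; apply: eq_bigr => i _; rewrite linearZ.
Qed.

Lemma regular_map_scale (V : lmodType k) (f : Defs.coord G) (F : G -> V) :
  regular_map F -> regular_map (fun x => evalG x f *: F x).
Proof.
move=> [n [g [e FE]]]; exists n, (fun i => f * g i), e => x.
rewrite FE scaler_sumr; apply: eq_bigr => i _.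
by rewrite scalerA rmorphM.
Qed.

Lemma regular_map_inv (V : lmodType k) (F : G -> V) :
  regular_map F -> regular_map (fun x => F x^-1%g).
Proof.
move=> [n [f [e FE]]]; have [g gE] := choice (fun i => evalG_inv (f i)).
by exists n, g, e => x; rewrite FE; apply: eq_bigr => i _; rewrite gE.
Qed.

End RegularMaps.

Section AlgebraAction.
Variables (k : closedFieldType) (G : affAlgGroup k) (R : ratAlgebra G).

Lemma ra_actB x (r s : R) : ra_act x (r - s) = ra_act x r - ra_act x s.
Proof. exact: (raddfB (@act _ _ (ra_mod R) x)). Qed.
Lemma ra_actD x (r s : R) : ra_act x (r + s) = ra_act x r + ra_act x s.
Proof. exact: (raddfD (@act _ _ (ra_mod R) x)). Qed.
Lemma ra_act1g (r : R) : ra_act 1%g r = r.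
Proof. exact: (act1 (r : ra_mod R)). Qed.
Lemma ra_actMg x y (r : R) : ra_act (x * y)%g r = ra_act x (ra_act y r).
Proof. exact: (actM _ _ (r : ra_mod R)). Qed.
Lemma ra_actVK x (r : R) : ra_act x (ra_act x^-1%g r) = r.
Proof. by rewrite -ra_actMg mulgV ra_act1g. Qed.

Lemma ra_act_unit x c : ra_act x (ra_unit R c) = ra_unit R c.
Proof.
have := linearZ_LR (mkLinear (act_linear (M := ra_mod R) x)) c (1 : R).
by rewrite /= !restr_scaleE /= ra_act_one /GRing.scale /= !mulr1.
Qed.

End AlgebraAction.

(** * Submodules with a rational semilinear action *)

Section SubGRModule.
Variables (k : closedFieldType) (G : affAlgGroup k) (R : ratAlgebra G).
Variables (U : lmodType R) (S : {pred U}) (clS : GRing.submod_closed S).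
Variable a : G -> U -> U.
Hypothesis a_semi :
  forall x (r : R) u v, a x (r *: u + v) = ra_act x r *: a x u + a x v.
Hypothesis a1 : forall u, a 1%g u = u.
Hypothesis aM : forall x y u, a (x * y)%g u = a x (a y u).
Hypothesis Sa : forall x u, u \in S -> a x u \in S.
Hypothesis Sreg : forall u, u \in S -> regular_map (V := restr (ra_unit R) U) (a^~ u).

Definition sub_act x (m : lsubmod clS) : lsubmod clS :=
  LSub (Sa x (valP m)).

Fact sub_act_rational :
  rational_action (M := restr (ra_unit R) (lsubmod clS)) sub_act.
Proof.
split; [move=> x c u v|move=> u|move=> x y u|move=> u].
- apply: val_inj; rewrite -[LHS]/(a x (ra_unit R c *: val u + val v)).
  by rewrite a_semi ra_act_unit.
- exact/val_inj/a1.
- exact/val_inj/aM.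
have i_lin : linear (fun m : restr (ra_unit R) (lsubmod clS) =>
  lsub_val m : restr (ra_unit R) U) by [].
pose i := mkLinear i_lin.
(* A k-linear retraction onto the submodule moves the coefficients of an orbit map into it. *)
have [p pE] := linear_extension (i := i) idfun val_inj.
have -> : sub_act^~ u = p \o (a^~ (val u)).
  by apply/funext => x /=; rewrite -[LHS]/(idfun _) -pE.
exact/regular_map_comp/Sreg/(valP u).
Qed.

Fact sub_act_scale x (r : R) (m : lsubmod clS) :
  sub_act x (r *: m) = ra_act x r *: sub_act x m.
Proof.
apply: val_inj => /=.
have a0 : a x 0 = 0.
  have /eqP := a_semi x 1 0 0.
  by rewrite ra_act_one !scale1r addr0 eq_sym addrC -subr_eq0 addrK => /eqP.
by have := a_semi x r (val m) 0; rewrite addr0 a0 addr0.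
Qed.

(** Rationality is assumed on [S] only, so that [U] may be a space of arbitrary functions on [G],
    where orbit maps need not be regular. *)
Definition sub_gr : grModule R := GRModule sub_act_rational sub_act_scale.

End SubGRModule.

(** * A criterion for injectivity by Zorn's lemma *)

Section InjectivityCriterion.
Variables (k : closedFieldType) (G : affAlgGroup k).

(** Graphs of equivariant linear maps from submodules of [B] to [I]; as relations they can be joined
    along chains. *)
Definition equivariant_graph (B I : ratModule G) (D : set (B * I)) : Prop :=
  [/\ D (0, 0), forall c p q, D p -> D q -> D (c *: p + q),
      forall v, D (0, v) -> v = 0 &
      forall x b v, D (b, v) -> D (act x b, act x v)].

(** Equivariance of [g] at the single vector [b] suffices to enlarge a maximal graph: the vectors on
    whose orbit [g] is equivariant form a submodule. *)
Lemma injective_criterion (I : ratModule G) :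
  (forall (B : ratModule G) (D : set (B * I)) (b : B), equivariant_graph D ->
    exists2 g : {linear B -> I}, forall d v, D (d, v) -> g d = v &
      forall x, g (act x b) = act x (g b)) ->
  injective_object I.
Proof.
move=> ext A B i f i_eq f_eq i_inj.
pose good (D : set (B * I)) :=
  equivariant_graph D /\ forall a, D (i a, f a).
have good0 : good [set (i a, f a) | a in [set: A]].
  split=> [|a]; last by exists a.
  split=> [|c _ _ [a _ <-] [b _ <-]|v [a _ [ia0 <-]]|x _ _ [a _ [<- <-]]].
  - by exists 0; rewrite // !linear0.
  - by exists (c *: a + b) => //; rewrite !linearP.
  - by rewrite (_ : a = 0) ?linear0 //; apply: i_inj; rewrite linear0.
  - by exists (act x a) => //; rewrite i_eq f_eq.
have [|D [[D_0|[gD Dif]] Dmax]] :=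
    @Zorn_bigcup (B * I)%type (fun D => D = set0 \/ good D).
- move=> F FP Ftot.
  have goodF D p : F D -> D p -> good D.
    by move=> FD Dp; have [E|//] := FP _ FD; rewrite E in Dp.
  have [[D0 [FD0 gD0]]|noF] := pselect (exists D, F D /\ good D); last first.
    left; rewrite -subset0 => p [D FD Dp]; apply: noF.
    by exists D; split=> //; apply: goodF FD Dp.
  right; split=> [|a]; last by exists D0 => //; case: gD0.
  split=> [|c p q [D1 FD1 p1] [D2 FD2 q2]|v [D FD Dv]|x b v [D FD Dbv]].
  + by exists D0 => //; case: gD0 => -[].
  + have [le|le] := Ftot _ _ FD1 FD2.
      have [[_ cl _ _] _] := goodF _ _ FD2 q2.
      by exists D2 => //; apply: cl => //; apply: le.
    have [[_ cl _ _] _] := goodF _ _ FD1 p1.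
    by exists D1 => //; apply: cl => //; apply: le.
  + by have [[_ _ + _] _] := goodF _ _ FD Dv; apply.
  + by exists D => //; have [[_ _ _ +] _] := goodF _ _ FD Dbv; apply.
- case: (Dmax [set (i a, f a) | a in [set: A]]); last by right.
  rewrite D_0; split=> [|/(_ (i 0, f 0))]; first exact: sub0set.
  by apply; exists 0.
have [D0 Dlin Dfun Dact] := gD.
have tot b : exists v, D (b, v).
  have [g gD_ gb] := ext B D b gD.
  (* The graph of [g] on the largest submodule where [g] is equivariant. *)
  pose E := [set p : B * I | g p.1 = p.2 /\ forall x, g (act x p.1) = act x p.2].
  have DE : D `<=` E.
    move=> [d v] Ddv; split=> [|x] /=; first exact: gD_.
    exact/gD_/Dact.
  suff DE1 : ~ (D `<` E).
    have [ED|nED] := pselect (E `<=` D); first by exists (g b); apply: ED.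
    by case: DE1; split.
  move=> /Dmax; case; right; split=> [|a]; last exact/DE/Dif.
  split=> [|c p q [p1 p2] [q1 q2]|v [/= + _]|x d v [/= gdv gx]].
  - exact: DE.
  - by split=> [|x] /=; rewrite !linearP /= ?p1 ?q1 ?p2 ?q2.
  - by rewrite linear0 => ->.
  - split=> [|y] /=; first by rewrite gx.
    by rewrite -!actM gx.
have [g gE] := linear_graph_extension D0 Dlin Dfun.
exists g => [x b|a]; last exact/gE/Dif.
by have [v Dbv] := tot b; rewrite (gE _ _ Dbv); apply/gE/Dact.
Qed.

End InjectivityCriterion.

(** * Extensions along an orbit, and injectivity of the algebra *)

Section OrbitModule.
Variables (k : closedFieldType) (G : affAlgGroup k) (R : ratAlgebra G).
Variables (B : ratModule G) (D : set (B * ra_mod R)) (b : B).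
Hypothesis gD : equivariant_graph D.

(* [None] carries the factor r and [Some x] the value at x of the function
   x |-> s (x b). *)
Definition orbit_val : lmodType R := option G -> R^o.

(** The conjugate of s by [y] has the value y s(y^-1 x b) at x b, whence the translated argument. *)
Definition orbit_act (y : G) (p : orbit_val) : orbit_val :=
  fun o => ra_act y (p (omap (fun x => y^-1 * x)%g o)).

Definition orbit_ext (p : orbit_val) (g : B -> R) : Prop :=
  [/\ linear (g : B -> ra_mod R), forall d v, D (d, v) -> g d = p None * v &
      forall x, p (Some x) = g (act x b)].

(** The extension [g] is only required to exist. Recording just its values on the orbit of [b] makes
    the action rational, which conjugation on all linear maps from [B] to [R] need not be. *)
Definition orbit_mem : {pred orbit_val} := fun p => `[< exists g, orbit_ext p g >].

Fact orbit_closed : GRing.submod_closed orbit_mem.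
Proof.
split=> [|r p q /asboolP[g [gl gD_ gp]] /asboolP[h [hl hD_ hp]]]; apply/asboolP.
  exists (fun=> 0); split=> [c u v|d v _|//]; last by rewrite mul0r.
  by rewrite scaler0 addr0.
exists (fun v => r * g v + h v); split=> [c u v|d v Ddv|x].
- rewrite gl hl !restr_scaleE /GRing.scale /= !mulrDr addrACA.
  by congr (_ + _); rewrite mulrCA.
- by rewrite (gD_ _ _ Ddv) (hD_ _ _ Ddv) /= mulrDl mulrA.
- by rewrite -gp -hp.
Qed.

Fact orbit_act_semi x (r : R) (u v : orbit_val) :
  orbit_act x (r *: u + v) = ra_act x r *: orbit_act x u + orbit_act x v.
Proof. by apply/funext => o; rewrite /orbit_act [LHS]ra_actD (ra_act_mul x r). Qed.

Fact orbit_act1 u : orbit_act 1%g u = u.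
Proof.
by apply/funext => -[x|]; rewrite /orbit_act ra_act1g //= invg1 mul1g.
Qed.

Fact orbit_actM x y u : orbit_act (x * y)%g u = orbit_act x (orbit_act y u).
Proof.
by apply/funext => -[z|]; rewrite /orbit_act ra_actMg //= invgM mulgA.
Qed.

Fact orbit_stable x u : u \in orbit_mem -> orbit_act x u \in orbit_mem.
Proof.
move=> /asboolP[g [gl gD_ gu]]; apply/asboolP.
exists (fun v => ra_act x (g (act x^-1%g v))); split=> [c v w|d v Ddv|y] /=.
- by rewrite linearP gl; apply: (act_linear (M := ra_mod R)).
- have [_ _ _ Dact] := gD.
  by rewrite /orbit_act (gD_ _ _ (Dact x^-1%g _ _ Ddv)) ra_act_mul ra_actVK.
- by rewrite /orbit_act /= gu actM.
Qed.

(** If x b is the sum of the f_i(x) e_i, the conjugate of [g] by y takes at x b the value sum of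
    f_i(y^-1 x) y g(e_i), and comultiplication separates y^-1 from x. *)
Fact orbit_regular u : u \in orbit_mem ->
  regular_map (V := restr (ra_unit R) orbit_val) (orbit_act^~ u).
Proof.
move=> /asboolP[g [gl _ gu]].
have [n [f [e eE]]] := act_rational b.
pose L (h : Defs.coord G) (r : ra_mod R) : restr (ra_unit R) orbit_val :=
  fun o => if o is Some x then ra_unit R (evalG x h) *: (r : R^o) else 0.
have L_lin h : linear (L h).
  move=> c r s; apply/funext => -[x|] /=; last by rewrite [RHS]addr0 [RHS]scaler0.
  rewrite scalerDr; congr (_ + _).
  by rewrite -[RHS]/(ra_unit R c *: (ra_unit R (evalG x h) *: (r : R^o)))
    !scalerA mulrC.
pose L0 (r : ra_mod R) : restr (ra_unit R) orbit_val :=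
  fun o => if o is Some x then 0 else r.
have L0_lin : linear L0.
  by move=> c r s; apply/funext => -[x|] //=; rewrite [RHS]addr0 [RHS]scaler0.
pose F i y : restr (ra_unit R) orbit_val :=
  fun o => if o is Some x then
    ra_unit R (evalG (y^-1 * x)%g (f i)) *: (ra_act y (g (e i)) : R^o) else 0.
have sumE m (h : 'I_m -> restr (ra_unit R) orbit_val) o :
    (\sum_(i < m) h i) o = \sum_(i < m) (h i o : R^o).
  exact: (congr1 (@^~ o) (@fct_sumE _ (option G) R^o _ xpredT h)).
have -> : orbit_act^~ u =
    \sum_(i < n) F i + (mkLinear L0_lin \o (fun y => ra_act y (u None))).
  apply/funext => y; apply/funext => o.
  rewrite -[RHS]/((\sum_(i < n) F i) y o + L0 (ra_act y (u None)) o).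
  rewrite fct_sumE sumE /orbit_act.
  case: o => [x|] /=; last by rewrite big1 ?add0r.
  rewrite addr0 gu eE.
  pose Ly : {linear B -> ra_mod R} := @act _ _ (ra_mod R) y \o mkLinear gl.
  rewrite -[LHS]/(Ly (\sum_(i < n) evalG (y^-1 * x)%g (f i) *: e i)) linear_sum.
  by apply: eq_bigr => i _; exact: linearZ_LR.
apply: regular_mapD; last exact/regular_map_comp/(act_rational (u None : ra_mod R)).
apply: regular_map_sum => i.
have [m [a [c fE]]] := evalG_mul (f i).
have -> : F i = \sum_(j < m) (fun y =>
    evalG y^-1%g (a j) *: mkLinear (L_lin (c j)) (ra_act y (g (e i)))).
  apply/funext => y; apply/funext => o; rewrite fct_sumE sumE.
  case: o => [x|] /=; last by rewrite big1 // => j _; exact: scaler0.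
  rewrite fE raddf_sum scaler_suml; apply: eq_bigr => j _.
  by rewrite /= rmorphM -scalerA.
apply: regular_map_sum => j.
have [a' a'E] := evalG_inv (a j).
under eq_fun do rewrite a'E.
apply/regular_map_scale/regular_map_comp.
exact: (act_rational (g (e i) : ra_mod R)).
Qed.

Definition orbit_mod : grModule R :=
  sub_gr orbit_closed orbit_act_semi orbit_act1 orbit_actM orbit_stable orbit_regular.

End OrbitModule.

Section LinearlyReductive.
Variables (k : closedFieldType) (G : affAlgGroup k) (R : ratAlgebra G).

Fact zero_ideal_proof (r : R) x : r = 0 -> ra_act x r = 0.
Proof. by move=> ->; have := ra_actB x (0 : R) 0; rewrite !subrr. Qed.

Definition zero_ideal : gIdeal R.
Proof.
refine (@GIdeal _ _ R [set 0] erefl _ _ (fun x r => @zero_ideal_proof r x)).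
- by move=> r s /= -> ->; rewrite addr0.
- by move=> a r /= ->; rewrite mulr0.
Defined.

Lemma linearly_reductive_injective : linearly_reductive R -> injective_object (ra_mod R).
Proof.
move=> lr; apply: injective_criterion => B D b gD.
have [D0 Dlin Dfun Dact] := gD.
have [f fE] := linear_graph_extension D0 Dlin Dfun.
pose la (p : orbit_mod b gD) : quotR zero_ideal := quotR_pi zero_ideal (lsub_val p None).
have la_lin : linear la.
  by move=> r p q; rewrite -[RHS](linearP (quotR_pi zero_ideal)).
have [||p p_fix pE] := lr _ _ (mkLinear la_lin).
- by move=> x p; rewrite -[RHS]/(quotR_act x (quotR_pi _ _)) quotR_actE.
- move=> q; pose r := quotR_repr q.
  (* The multiple r f of a linear extension [f] lies over [r]; [f] need not be equivariant. *)
  pose s : orbit_val R := fun o => if o is Some x then r * f (act x b) else r.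
  have s_mem : s \in orbit_mem D b.
    apply/asboolP; exists (fun v => r * f v); split=> [c u v|d v Ddv|//].
      by rewrite linearP mulrDr; congr (_ + _); apply: mulrCA.
    by rewrite (fE _ _ Ddv).
  by exists (LSub s_mem); exact: quotR_reprK.
have p1 : lsub_val p None = 1.
  by have /quotR_piP := pE; move=> /= /eqP; rewrite subr_eq0 => /eqP.
have /asboolP[g [gl gD_ gp]] := lsub_valP p.
exists (mkLinear gl) => [d v Ddv|x] /=; first by rewrite (gD_ _ _ Ddv) p1 mul1r.
(* The component of x p = p at [Some x] reads x g(x^-1 x b) = g(x b). *)
have := congr1 (fun q => lsub_val q (Some x)) (p_fix x).
by rewrite /= /orbit_act /= mulVg !gp act1 => <-.
Qed.

End LinearlyReductive.

(** * A total integral from injectivity *)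

Section TotalIntegral.
Variables (k : closedFieldType) (G : affAlgGroup k) (R : ratAlgebra G).

Fact trivial_rational : rational_action (G := G) (fun (_ : G) (c : k^o) => c).
Proof.
split=> // c; exists 1, (fun=> 1), (fun=> c) => x.
by rewrite big_ord1 rmorph1 scale1r.
Qed.

Definition trivial_mod : ratModule G := RatModule trivial_rational.

Lemma injective_total_integral : injective_object (ra_mod R) ->
  exists sigma : {linear coord_mod G -> ra_mod R}, total_integral sigma.
Proof.
move=> inj.
have i_lin : linear (fun c : trivial_mod => c%:A : coord_mod G).
  by move=> c u v; rewrite scalerDl scalerA.
have f_lin : linear (fun c : trivial_mod => ra_unit R c : ra_mod R).
  by move=> c u v; rewrite rmorphD rmorphM.
have evalA x (c : k) : evalG x (c%:A) = c.
  by rewrite linearZ /= rmorph1; apply: mulr1.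
have [|||s s_eq sE] := inj _ _ (mkLinear i_lin) (mkLinear f_lin).
- move=> x c; apply: evalG_inj => y /=.
  by rewrite evalG_rtrans !evalA.
- by move=> x c; rewrite /= ra_act_unit.
- by move=> c d /= /(congr1 (evalG 1%g)); rewrite !evalA.
exists s; split=> //.
have := sE (1 : k); by rewrite /= scale1r rmorph1.
Qed.

End TotalIntegral.

(** * Retractions of the coaction from a total integral *)

Section Retraction.
Variables (k : closedFieldType) (G : affAlgGroup k).

(** Equivalent to injectivity of [M], as cofree modules are injective; this form passes easily to
    cokernels. *)
Definition coaction_split (M : ratModule G) : Prop :=
  exists2 p : {linear cofree_mod G M -> M}, equivariant p & cancel (@coaction k G M) p.

Lemma injective_split (M : ratModule G) : injective_object M -> coaction_split M.
Proof.
move=> inj; have [//||p p_eq pE] :=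
  inj _ _ (@coaction k G M) idfun (@coaction_equiv k G M).
  exact: coaction_inj.
by exists p.
Qed.

Lemma split_injective (M : ratModule G) : coaction_split M -> injective_object M.
Proof.
move=> [p p_eq pK] A B i f i_eq f_eq i_inj.
have [|g g_eq gE] := cofree_injective (f := @coaction k G M \o f) i_eq _ i_inj.
  by move=> x a; rewrite /= f_eq coaction_equiv.
exists (p \o g) => [x b|a] /=; first by rewrite g_eq p_eq.
by rewrite gE /= pK.
Qed.

Variables (R : ratAlgebra G) (sigma : {linear coord_mod G -> ra_mod R}).
Hypothesis sigmaP : total_integral sigma.
Variable M : grModule R.

Local Notation kM := (gr_mod M).

(* If a functional [q] has [q (e n) = 1], then [f n] is a combination of the
   other [f i], which reduces the number of terms. *)
Lemma integral_tensor_eq0 n (f : 'I_n -> Defs.coord G) (e : 'I_n -> kM) :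
  (forall x, \sum_(i < n) evalG x (f i) *: e i = 0) ->
  \sum_(i < n) (sigma (f i) : R) *: (e i : M) = 0.
Proof.
elim: n f e => [|n IHn] f e fe0; first by rewrite big_ord0.
rewrite big_ord_recr /=.
set f' := fun i => f (widen_ord (leqnSn n) i).
set e' := fun i => e (widen_ord (leqnSn n) i).
have {}fe0 x : \sum_(i < n) evalG x (f' i) *: e' i + evalG x (f ord_max) *: e ord_max = 0.
  by have := fe0 x; rewrite big_ord_recr.
have [e0|/nonzero_functional[q qe]] := eqVneq (e ord_max) 0.
  rewrite e0 [_ *: 0]scaler0 addr0; apply: (IHn f' e') => x.
  by have := fe0 x; rewrite e0 scaler0 addr0.
have fE : f ord_max = - \sum_(i < n) q (e' i) *: f' i.
  apply: evalG_inj => x; apply/eqP.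
  rewrite raddfN -addr_eq0 addrC; apply/eqP.
  have := congr1 q (fe0 x); rewrite linear0 linearD linearZ /= qe => <-.
  rewrite !linear_sum; congr (_ + _); last by rewrite [RHS]mulr1.
  by apply: eq_bigr => i _; rewrite !linearZ /= [LHS]mulrC.
have := IHn f' (fun i => e' i - q (e' i) *: e ord_max).
have -> : sigma (f ord_max) =
    - \sum_(i < n) ra_unit R (q (e' i)) * (sigma (f' i) : R) :> R.
  by rewrite fE linearN linear_sum; congr (- _); apply: eq_bigr => i _; rewrite linearZ.
move=> IH; rewrite scaleNr scaler_suml -sumrB -[RHS]IH => [|x].
  by apply: eq_bigr => i _; rewrite scalerBr mulrC -scalerA.
rewrite -[RHS](fe0 x).
have -> : evalG x (f ord_max) = - \sum_(i < n) q (e' i) * evalG x (f' i).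
  by rewrite fE linearN linear_sum; congr (- _); apply: eq_bigr => i _; rewrite linearZ.
rewrite scaleNr scaler_suml -sumrB; apply: eq_bigr => i _.
by rewrite scalerBr scalerA mulrC.
Qed.

(** The graph of the retraction, ranging over all expressions of x |-> x^-1 F(x) as a sum of
    tensors; [integral_tensor_eq0] gives independence of the expression. *)
Definition integral_graph (p : cofree_mod G kM * kM) : Prop :=
  exists (n : nat) (f : 'I_n -> Defs.coord G) (e : 'I_n -> kM),
    (forall x, act x^-1%g (cofree_fun p.1 x) = \sum_(i < n) evalG x (f i) *: e i) /\
    p.2 = \sum_(i < n) (sigma (f i) : R) *: (e i : M).

Lemma integral_graph_linear c p q :
  integral_graph p -> integral_graph q -> integral_graph (c *: p + q).
Proof.
move=> [n [f [e [pf pm]]]] [n' [f' [e' [qf qm]]]].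
exists (n + n')%N,
  (fun i => match fintype.split i with inl j => f j | inr j => f' j end),
  (fun i => match fintype.split i with inl j => c *: e j | inr j => e' j end).
split=> [x|].
  rewrite big_split_ord -[(c *: p + q).1]/(c *: p.1 + q.1) cofree_fun_linear.
  rewrite [LHS]act_linear pf qf scaler_sumr; congr (_ + _); apply: eq_bigr => j _;
    rewrite ?(unsplitK (inl j)) ?(unsplitK (inr j)) //.
  by rewrite !scalerA mulrC.
rewrite big_split_ord /= pm qm.
congr (_ + _); last by apply: eq_bigr => j _; rewrite (unsplitK (inr j)).
rewrite -[LHS]/(ra_unit R c *: \sum_(i < n) (sigma (f i) : R) *: (e i : M)) scaler_sumr.
apply: eq_bigr => j _; rewrite (unsplitK (inl j)).
by rewrite -[in RHS]/(ra_unit R c *: (e j : M)) !scalerA mulrC.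
Qed.

Lemma integral_graph_total (F : cofree_mod G kM) : exists m, integral_graph (F, m).
Proof.
have [n [f [e FE]]] := cofreeP F.
suff [m [g [h gh]]] : regular_map (fun x => act x^-1%g (cofree_fun F x)).
  by exists (\sum_(i < m) (sigma (g i) : R) *: (h i : M)), m, g, h.
have -> : (fun x => act x^-1%g (cofree_fun F x)) =
    \sum_(i < n) (fun x => evalG x (f i) *: act x^-1%g (e i)).
  apply/funext => x; rewrite fct_sumE FE linear_sum.
  by apply: eq_bigr => i _; rewrite linearZ.
apply: regular_map_sum => i; apply: regular_map_scale.
exact: regular_map_inv (act_rational (e i)).
Qed.

(** As (y F)(x) = F(x y) and x^-1 = y (x y)^-1, acting on [F] translates each [f i] and applies [y]
    to each [e i]; equivariance of [sigma] then gives the result. *)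
Lemma integral_graph_act y F m :
  integral_graph (F, m) -> integral_graph (act y F, act y m).
Proof.
move=> [n [f [e [Ff mE]]]]; move: mE => /= ->.
exists n, (fun i => rtrans y (f i)), (fun i => act y (e i)).
split=> [x|].
  rewrite cofree_actE (_ : x^-1 = y * (x * y)^-1)%g; last first.
    by rewrite invgM mulgA mulgV mul1g.
  rewrite [LHS]actM (Ff (x * y)%g) linear_sum; apply: eq_bigr => i _.
  by rewrite linearZ evalG_rtrans.
rewrite [LHS](linear_sum (act y : {linear kM -> kM})).
apply: eq_bigr => i _; rewrite [LHS]gr_act_scale.
case: sigmaP => s_eq _.
by have /= <- := s_eq y (f i).
Qed.

Lemma total_integral_split : coaction_split kM.
Proof.
have [|c p q|m|g gE] := @linear_graph_extension k _ _ integral_graph.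
- exists 0, (fun=> 0), (fun=> 0); split=> [x|]; rewrite big_ord0 //.
  exact: (linear0 (act x^-1%g : {linear kM -> kM})).
- exact: integral_graph_linear.
- move=> [n [f [e [/= fe0 ->]]]]; apply: integral_tensor_eq0 => x.
  by rewrite -fe0; exact: (linear0 (act x^-1%g : {linear kM -> kM})).
exists g => [x F|m].
  have [m Fm] := integral_graph_total F.
  by rewrite (gE _ _ Fm); apply/gE/integral_graph_act.
(* For F the coaction of [m], the map x |-> x^-1 F(x) is constant, the tensor of 1 and [m]. *)
apply: gE; exists 1, (fun=> 1), (fun=> m); split=> [x|].
  by rewrite big_ord1 rmorph1 scale1r -[LHS]/(act _ (act x m)) -actM mulVg act1.
by case: sigmaP => _ s1; rewrite big_ord1 s1 scale1r.
Qed.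

End Retraction.

(** * Split syzygies and vanishing cohomology *)

Section Syzygies.
Variables (k : closedFieldType) (G : affAlgGroup k).

Lemma coaction_fixed (M : ratModule G) m :
  fixed (cofree_mod G M) (coaction m) -> fixed M m.
Proof. by move=> cm x; apply: coaction_inj; rewrite coaction_equiv cm. Qed.

(** The identity minus the coaction after [p] kills the image of the coaction and moves elements
    only within their class, so it descends to a section. *)
Lemma split_coker_section (M : ratModule G) : coaction_split M ->
  exists2 s : {linear coker_mod M -> cofree_mod G M}, equivariant s &
    cancel s (coker_pi M).
Proof.
move=> [p p_eq pK].
pose t : {linear cofree_mod G M -> cofree_mod G M} := idfun \- (@coaction k G M \o p).
have t_eq F F' : coker_pi M F = coker_pi M F' -> t F = t F'.
  move=> /coker_piP[m FF']; apply/eqP.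
  by rewrite -subr_eq0 -linearB -FF' /= pK subrr.
pose s (q : coker_mod M) : cofree_mod G M := t (lquot_repr q).
have sE F : s (coker_pi M F) = t F by apply: t_eq; rewrite coker_reprK.
have s_lin : linear s.
  move=> c a b; rewrite -(coker_reprK a) -(coker_reprK b) -linearP !sE.
  exact: linearP.
exists (mkLinear s_lin) => [x q|q] /=.
  rewrite -(coker_reprK q) coker_actE !sE.
  rewrite /= p_eq coaction_equiv.
  exact/esym/(raddfB (act x : {linear cofree_mod G M -> cofree_mod G M})).
rewrite -[RHS]coker_reprK; apply/coker_piP.
by exists (- p (lquot_repr q)); rewrite linearN /s /= [RHS]addrC addKr.
Qed.

(** Extend the section [s] along the coaction of the cokernel, by injectivity of the cofree module,
    and project. *)
Lemma coker_split (M : ratModule G) : coaction_split M -> coaction_split (coker_mod M).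
Proof.
move=> /split_coker_section[s s_eq sK].
have [|g g_eq gE] := cofree_injective (@coaction_equiv _ _ (coker_mod M)) s_eq _.
  exact: coaction_inj.
exists (coker_pi M \o g : {linear _ -> coker_mod M}) => [x F|q] /=.
  by rewrite g_eq -coker_actE.
by rewrite gE sK.
Qed.

Lemma syzygy_split (M : ratModule G) n : coaction_split M -> coaction_split (syzygy M n).
Proof. by move=> Ms; elim: n => //= n; apply: coker_split. Qed.

Lemma ratH_eq0 (M : ratModule G) n :
  (forall h : ratH n M, h = 0) <->
  forall z : res (std_resolution M) n, fixed _ z -> diff (std_resolution M) n z = 0 ->
    coboundary z.
Proof.
split=> [H0 z zf dz|H0 h].
  pose c : cocycle (std_resolution M) n := LSub (introT (asboolP _) (conj zf dz)).
  have /lquot_piP : lquot_pi (coboundary_closed (std_resolution M) n) c = lquot_pi _ 0.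
    by rewrite linear0; apply: H0.
  by rewrite subr0 => /asboolP.
rewrite -(lquot_reprK h) -(linear0 (lquot_pi _)); apply/lquot_piP.
rewrite subr0; apply/asboolP.
by have /asboolP[] := lsub_valP (lquot_repr h); apply: H0.
Qed.

(** A fixed cocycle of positive degree is the coaction of a fixed [q] in a syzygy; an equivariant
    section lifts [q] to a fixed preimage under the differential. *)
Lemma split_ratH_eq0 (M : ratModule G) n : coaction_split M -> n <> 0%N ->
  forall h : ratH n M, h = 0.
Proof.
case: n => // n Ms _; apply/ratH_eq0 => z zf /std_ker[q qz].
have [s s_eq sK] := split_coker_section (syzygy_split n Ms).
rewrite -qz in zf *; exists (s q).
  by move=> x; rewrite -[LHS]s_eq (coaction_fixed zf).
by rewrite -[LHS]/(coaction (coker_pi _ (s q) : syzygy M n.+1)) sK.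
Qed.

End Syzygies.

(** * Lifting fixed elements along a surjection *)

Section Kernel.
Variables (k : closedFieldType) (G : affAlgGroup k) (R : ratAlgebra G).
Variables (M N : grModule R) (phi : {linear M -> N}).
Hypothesis phi_eq : gr_equivariant phi.

Definition ker_mem : {pred M} := fun m => phi m == 0.
Fact ker_closed : GRing.submod_closed ker_mem.
Proof.
split=> [|r u v /eqP u0 /eqP v0]; apply/eqP; first exact: linear0.
by rewrite linearP u0 v0 scaler0 addr0.
Qed.

Fact ker_act_semi x (r : R) (u v : M) :
  gr_act x (r *: u + v) = ra_act x r *: gr_act x u + gr_act x v.
Proof.
rewrite -gr_act_scale.
exact: (raddfD (act x : {linear gr_mod M -> gr_mod M})).
Qed.

Fact ker_stable x u : u \in ker_mem -> gr_act x u \in ker_mem.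
Proof.
move=> /eqP u0; apply/eqP; rewrite phi_eq u0.
exact: (linear0 (act x : {linear gr_mod N -> gr_mod N})).
Qed.

Definition ker_gr : grModule R :=
  sub_gr ker_closed ker_act_semi (@act1 _ _ (gr_mod M)) (@actM _ _ (gr_mod M)) 
    ker_stable (fun u _ => act_rational (u : gr_mod M)).

Lemma fixed_lift (n : N) : (forall h : ratH 1 (gr_mod ker_gr), h = 0) ->
  (forall q, exists m, phi m = q) -> gr_fixed N n -> exists2 m, gr_fixed M m & phi m = n.
Proof.
move=> /ratH_eq0 H1 phi_surj n_fix; pose K := gr_mod ker_gr.
have i_lin : linear (fun m : K => lsub_val m : gr_mod M) by [].
have [//||h h_eq hE] := cofree_injective (i := mkLinear i_lin)
    (f := @coaction k G K) _ (@coaction_equiv _ _ K) _.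
  exact: val_inj.
have {}hE (v : K) : h (lsub_val v) = coaction v := hE v.
have liftK u : phi u = 0 -> exists v : K, lsub_val v = u.
  by move=> /eqP u0; exists (LSub (S := ker_mem) u0).
have phi_fix m x : phi m = n -> phi (gr_act x m - m) = 0.
  by move=> mn; rewrite linearB phi_eq mn n_fix subrr.
have [m mn] := phi_surj n.
(* The coaction of [q] is a 1-cocycle; [q] is fixed because x m - m lies in [K], where [h] is the
   coaction. *)
pose q : coker_mod K := coker_pi K (h m).
have q_fix : fixed (coker_mod K) q.
  move=> x; rewrite [LHS]coker_actE; apply/coker_piP.
  have [v vE] := liftK _ (phi_fix m x mn); exists v.
  by rewrite -hE vE linearB; congr (_ - _); exact: h_eq.
have [x||y y_fix yE] := H1 (coaction q).
- by rewrite -coaction_equiv q_fix.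
- by apply/std_ker; exists q.
have [v vE] : exists v, coaction v = h m - y.
  apply/coker_piP; apply: (@coaction_inj _ _ (coker_mod K)); exact/esym.
exists (m - lsub_val v) => [x|]; last first.
  by rewrite linearB mn; have /eqP -> := lsub_valP v; rewrite subr0.
have hmv : h (m - lsub_val v) = y.
  by rewrite linearB hE vE opprB addrC subrK.
have [|w wE] := liftK (gr_act x (m - lsub_val v) - (m - lsub_val v)).
  apply: phi_fix; rewrite linearB mn; have /eqP -> := lsub_valP v; exact: subr0.
(* On [K] the map [h] is the injective coaction, and it kills x (m - v) - (m - v) because h(m - v) =
   y is fixed. *)
suff w0 : w = 0 by apply/eqP; rewrite -subr_eq0 -wE w0.
apply: coaction_inj; rewrite -hE linear0 wE linearB.
by rewrite [h (gr_act _ _)]h_eq hmv y_fix subrr.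
Qed.

End Kernel.

(** * Assembling the equivalences *)

Lemma fixed_surj_linearly_reductive (k : closedFieldType) (G : affAlgGroup k)
    (R : ratAlgebra G) :
  (forall (M N : grModule R) (phi : {linear M -> N}),
     gr_equivariant phi -> (forall q, exists m, phi m = q) ->
     phi @` gr_fixed M = gr_fixed N) -> linearly_reductive R.
Proof.
move=> fs M J la la_eq la_surj.
have : gr_fixed (quotR_mod J) (quotR_pi J 1).
  by move=> x; rewrite [LHS]quotR_actE ra_act_one.
by rewrite -(fs _ _ la la_eq la_surj) => -[m m_fix mE]; exists m.
Qed.

Theorem theorem2p4 (k : closedFieldType) (G : affAlgGroup k)
    (R : ratAlgebra G) :
  [<-> linearly_reductive R;
       forall (M N : grModule R) (phi : {linear M -> N}),
         gr_equivariant phi -> (forall q, exists m, phi m = q) ->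
         phi @` gr_fixed M = gr_fixed N;
       forall (M : grModule R) (n : nat), n <> 0%N ->
         forall h : ratH n (gr_mod M), h = 0;
       exists sigma : {linear coord_mod G -> ra_mod R}, total_integral sigma;
       injective_object (ra_mod R);
       forall M : grModule R, injective_object (gr_mod M)].
Proof.
have h43 : (exists sigma : {linear coord_mod G -> ra_mod R}, total_integral sigma) ->
    forall M : grModule R, coaction_split (gr_mod M).
  by move=> [s sP] M; apply: total_integral_split sP _.
have h32 : (forall (M : grModule R) (n : nat), n <> 0%N ->
      forall h : ratH n (gr_mod M), h = 0) ->
    forall (M N : grModule R) (phi : {linear M -> N}),
      gr_equivariant phi -> (forall q, exists m, phi m = q) ->
      phi @` gr_fixed M = gr_fixed N.
  move=> H0 M N phi phi_eq phi_surj; apply/seteqP; split=> [_ [m m_fix <-] x|n n_fix].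
    by rewrite -phi_eq m_fix.
  have [|m m_fix mn] := fixed_lift (phi_eq := phi_eq) _ phi_surj n_fix; first exact: H0.
  by exists m.
have h14 : linearly_reductive R ->
    exists sigma : {linear coord_mod G -> ra_mod R}, total_integral sigma.
  by move=> /linearly_reductive_injective /injective_total_integral.
(* The links follow the order of the statement, so each is a composite of [h14], [h43], [h32] and
   the lemmas above. *)
tfae.
- move=> /h14/h43 Ms; apply: h32 => M n; exact: split_ratH_eq0.
- move=> /fixed_surj_linearly_reductive/h14/h43 Ms M n; exact: split_ratH_eq0.
- by move=> /h32/fixed_surj_linearly_reductive/h14.
- move=> /h43 Ms.
  (* [R] as a module over itself, with underlying rational module [ra_mod R]. *)
  pose R1 : grModule R := @GRModule k G R R^o _ (ra_actP R) (@ra_act_mul k G R).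
  exact: (split_injective (Ms R1)).
- move=> /injective_total_integral/h43 Ms M; exact: split_injective.
- move=> inj; apply/fixed_surj_linearly_reductive/h32 => M n.
  exact/split_ratH_eq0/injective_split.
Qed.
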